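(* Let $G$ be a connected graph on $n \ge 2$ vertices, and let $\overline{G}$ denote its complement. (a) If $\overline{G}$ is connected, then $\operatorname{fd}(G) = \operatorname{fd}(\overline{G})$. (b) If $\overline{G}$ has $q \ge 2$ components, then $\operatorname{fd}(G) \le n/q \le n/2$.
   Context: All graphs are finite and simple; $N(v)$ denotes the open neighborhood of $v$. For a graph $G=(V,E)$ and an integer $k \ge 1$, a $k$-fair dominating set is a dominating set $D \subseteq V$ such that $|N(v) \cap D| = k$ for every $v \in V \setminus D$ (the set $D = V$ qualifies vacuously). A fair dominating set (FD-set) is a set that is a $k$-fair dominating set for some $k \ge 1$. If $G$ has at least one edge, $\operatorname{fd}(G)$ is the minimum cardinality of an FD-set of $G$; by convention, $\operatorname{fd}(\overline{K_n}) = n$ for the edgeless graph on $n$ vertices. *)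

(* Defs.v *)
From mathcomp Require Import all_boot all_order all_algebra.

Set Implicit Arguments.
Unset Strict Implicit.
Unset Printing Implicit Defensive.

Record sgraph (T : finType) := SGraph {
  adj : rel T;
  adj_sym : symmetric adj;
  adj_irr : irreflexive adj
}.

Section Graph.
Variables (T : finType) (G : sgraph T).
Implicit Types (D : {set T}) (v : T) (k : nat).

Definition neighborhood v : {set T} := [set u | adj G v u].

Definition cograph_adj : rel T := fun x y => (x != y) && ~~ adj G x y.

Fact cograph_adj_sym : symmetric cograph_adj.
Proof. by move=> x y; rewrite /cograph_adj eq_sym adj_sym. Qed.

Fact cograph_adj_irr : irreflexive cograph_adj.
Proof. by move=> x; rewrite /cograph_adj eqxx. Qed.

Definition cograph : sgraph T := SGraph cograph_adj_sym cograph_adj_irr.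

Definition connected : Prop := forall x y : T, connect (adj G) x y.

Definition num_components : nat := n_comp (adj G) T.

Definition has_edge : bool := [exists x, exists y, adj G x y].

Definition dominating D : bool :=
  [forall (v | v \notin D), exists u in D, u \in neighborhood v].

Definition kfair_dominating k D : bool :=
  dominating D && [forall (v | v \notin D), #|neighborhood v :&: D| == k].

(* Bounding k keeps the predicate boolean and loses nothing: see fd_setP. *)
Definition fd_set D : bool :=
  [exists k : 'I_#|T|.+2, (1 <= k) && kfair_dominating k D].

Lemma fd_setP D :
  reflect (exists k, 1 <= k /\ kfair_dominating k D) (fd_set D).
Proof.
apply: (iffP existsP) => [[k /andP[k1 kD]] | [k [k1 kD]]]; first by exists k.
have [lekT | ltTk] := leqP k #|T|.+1.
  by exists (Ordinal (lekT : k < #|T|.+2)); rewrite /= k1.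
exists (Ordinal (isT : 1 < #|T|.+2)) => /=.
case/andP: kD => domD /forall_inP fairD; rewrite /kfair_dominating domD /=.
apply/forall_inP => v vD; have /eqP eqk := fairD v vD.
by have := max_card (mem (neighborhood v :&: D)); rewrite eqk leqNgt (ltnW ltTk).
Qed.

Lemma fd_setT : fd_set [set: T].
Proof.
apply/fd_setP; exists 1; split=> //.
by apply/andP; split; apply/forall_inP => v; rewrite in_setT.
Qed.

(* [set: T] is only the witness required by arg min; it is an FD-set by
   fd_setT, and fd_minimum shows that the value is the intended minimum. *)
Definition fd : nat :=
  if has_edge then #|[arg min_(D < [set: T] | fd_set D) #|D|]| else #|T|.

Lemma fd_minimum : has_edge ->
  (exists2 D, fd_set D & fd = #|D|) /\ (forall D, fd_set D -> fd <= #|D|).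
Proof.
rewrite /fd => ->; case: arg_minnP => [|D fdD minD]; first exact: fd_setT.
by split=> //; exists D.
Qed.

End Graph.

(* Main.v *)
(* Off D, a vertex with k neighbours in D has #|D| - k co-neighbours in D, so
   fairness passes to the complement unless k = #|D|; but then D is joined
   completely to its complement, so the complement of G is disconnected. If it
   is disconnected, each of its components is such a D, hence an FD-set of G,
   and the q components partition the n vertices. *)
Require Import Defs.
From mathcomp Require Import all_boot all_order all_algebra.

Set Implicit Arguments.
Unset Strict Implicit.
Unset Printing Implicit Defensive.

Section FairDomination.
Variable T : finType.
Implicit Types (G H : sgraph T) (D : {set T}).

Lemma connected_has_edge G : 2 <= #|T| -> connected G -> has_edge G.
Proof.
move=> /card_gt1P [x [y [_ _ neq_xy]]] /(_ x y) /connectP [[|z p] /=].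
  by move=> _ eq_yx; rewrite eq_yx eqxx in neq_xy.
by case/andP=> adj_xz _ _; apply/existsP; exists x; apply/existsP; exists z.
Qed.

Lemma card_neighborhood_gt0 G D k v :
  kfair_dominating G k D -> v \notin D -> 0 < #|neighborhood G v :&: D|.
Proof.
move=> /andP[/forall_inP domD _] /domD /exists_inP[u uD uN].
by apply/card_gt0P; exists u; rewrite inE uN.
Qed.

(** Domination comes for free: a positive count already provides a neighbour in [D]. *)
Lemma fd_set_intro G k D : 1 <= k ->
  (forall v, v \notin D -> #|neighborhood G v :&: D| = k) -> fd_set G D.
Proof.
move=> k_gt0 fairD; apply/fd_setP; exists k; split=> //.
apply/andP; split; apply/forall_inP => v vD; last by rewrite fairD.
have /card_gt0P[u] : 0 < #|neighborhood G v :&: D| by rewrite fairD.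
by rewrite inE => /andP[uN uD]; apply/exists_inP; exists u.
Qed.

(* H plays the complement of G; stating this through adj, rather than as
   cograph G, makes the roles of G and H exchangeable. *)
Lemma fd_set_compl G H D :
    (forall x y, adj H x y = (x != y) && ~~ adj G x y) ->
  connected H -> fd_set G D -> fd_set H D.
Proof.
move=> adjH connH /fd_setP[k [k_gt0 fairD]].
(* The full set is set aside: without a vertex outside [D], nothing ties [k] to [#|D|]. *)
have [/eqP -> | ] := boolP (D == setT); first exact: fd_setT.
rewrite -subTset => /subsetPn[v _ vD].
have fairP w : w \notin D -> #|neighborhood G w :&: D| = k.
  by case/andP: fairD => _ /forall_inP /[apply] /eqP.
have coN w : w \notin D -> neighborhood H w :&: D = D :\: neighborhood G w.
  move=> wD; apply/setP=> x; rewrite !inE adjH.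
  have [xD | _] := boolP (x \in D); last by rewrite !andbF.
  by rewrite !andbT; case: eqP wD => // ->; rewrite xD.
have coN_card w : w \notin D -> #|neighborhood H w :&: D| = #|D| - k.
  by move=> wD; rewrite coN // cardsD setIC fairP.
(* It remains to see [k < #|D|]; the vertex [v] gives [k <= #|D|]. *)
apply: (fd_set_intro _ coN_card); rewrite subn_gt0 ltn_neqAle.
rewrite -{2}(fairP v vD) subset_leq_card ?subsetIr // andbT.
apply/negP=> /eqP k_D.
have [u] := card_gt0P (card_neighborhood_gt0 fairD vD).
rewrite inE => /andP[_ uD].
(* If [k = #|D|], no edge of [H] leaves [D], yet a path of [H] joins [u] in [D] to [v] outside. *)
suff closedD : closed (adj H) D.
  by have := closed_connect closedD (connH u v); rewrite uD (negPf vD).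
apply: (intro_closed (sym_connect_sym (@adj_sym _ H))) => x y adj_xy xD.
apply/negPn/negP=> yD; have /eqP := coN_card y yD.
rewrite k_D subnn cards_eq0 => /eqP/setP/(_ x).
by rewrite !inE adj_sym adj_xy xD.
Qed.

(** Connectedness on two or more vertices gives both graphs an edge, so both values of [fd] are true
    minima. *)
Lemma fd_le_compl G H :
    (forall x y, adj H x y = (x != y) && ~~ adj G x y) ->
  2 <= #|T| -> connected G -> connected H -> fd H <= fd G.
Proof.
move=> adjH T_ge2 connG connH.
have [[D fdD ->] _] := fd_minimum (connected_has_edge T_ge2 connG).
have [_ minH] := fd_minimum (connected_has_edge T_ge2 connH).
exact/minH/(fd_set_compl adjH).
Qed.

(** A vertex outside a co-component is adjacent in [G] to all of it, so the component is fair with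
    [k] its own size. *)
Lemma fd_le_cograph_component G x : has_edge G ->
  fd G <= #|[set y | connect (adj (cograph G)) x y]|.
Proof.
move=> edgeG; have [_ minG] := fd_minimum edgeG; apply: minG.
set D := [set y | _].
apply: (@fd_set_intro G #|D|) => [|v vD].
  by apply/card_gt0P; exists x; rewrite inE connect0.
congr #|pred_of_set _|; apply/setIidPr/subsetP=> y yD; rewrite inE adj_sym.
apply: contraR vD => nadj_yv; move: yD; rewrite !inE => conn_xy.
have [<- //| neq_yv] := eqVneq y v.
by apply: connect_trans conn_xy (connect1 _); rewrite /= /cograph_adj neq_yv.
Qed.

Lemma sum_card_components G :
  \sum_(x | roots (adj G) x) #|[set y | connect (adj G) x y]| = #|T|.
Proof.
have symG := sym_connect_sym (@adj_sym _ G).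
rewrite -sum1_card.
(* Vertices are grouped by the canonical representative of their component. *)
rewrite [RHS](partition_big (fingraph.root (adj G)) (roots (adj G))) /=.
  apply: eq_bigr => x /eqP rootx; rewrite -sum1_card.
  by apply: eq_bigl => y; rewrite !inE -root_connect // rootx eq_sym.
by move=> y _; apply: roots_root.
Qed.

End FairDomination.

Theorem theorem1 (n : nat) (T : finType) (G : sgraph T)
    (card_T : #|T| = n) (n_ge2 : 2 <= n) (G_conn : connected G) :
  (connected (cograph G) -> fd G = fd (cograph G)) /\
  (forall q : nat, num_components (cograph G) = q -> 2 <= q ->
    (((fd G)%:R <= n%:R / q%:R :> rat) /\ (n%:R / q%:R <= n%:R / 2%:R :> rat))%R).
Proof.
subst n; split=> [coG_conn | q comp_q q_ge2].
  apply/eqP; rewrite eqn_leq !fd_le_compl // => x y.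
  (* Complementation is an involution, by irreflexivity on the diagonal; this gives the second
     inequality. *)
  rewrite /= /cograph_adj negb_and !negbK.
  by case: eqVneq => // ->; rewrite adj_irr.
have q_gt0 : (0 < q%:R :> rat)%R by rewrite Num.Theory.ltr0n ltnW.
split.
  rewrite Num.Theory.ler_pdivlMr // -GRing.natrM Num.Theory.ler_nat.
  rewrite -(sum_card_components (cograph G)).
  (* One copy of [fd G] per co-component, to be compared term by term with the component sizes. *)
  have -> : fd G * q = \sum_(x | roots (adj (cograph G)) x) fd G.
    rewrite -comp_q mulnC -sum_nat_const; apply: eq_bigl => x.
    by rewrite inE andbT.
  by apply: leq_sum => x _; apply/fd_le_cograph_component/connected_has_edge.
rewrite Num.Theory.ler_wpM2l ?Num.Theory.ler0n // Num.Theory.lef_pV2 //.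
by rewrite Num.Theory.ler_nat.
Qed.
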